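(* Let $q$ be a prime power and $f \in \mathbb{F}_q[x]$ a nonzero polynomial. Suppose that $f$ has distinct (i.e. non-associate) irreducible factors $f_1, f_2$ of the same degree. Let $a_1, a_2$ be two positive integers such that $f_1^{a_1} \,\|\, f$ and $f_2^{a_2} \,\|\, f$. Let $$D_1 = \mathrm{Div}(f_1^{a_1}), \qquad D_2 = \mathrm{Div}(f_2^{a_2}).$$ Then $G_f(D_1) \cong G_f(D_2)$.
   Context: For an irreducible polynomial $g$, $g^a \,\|\, f$ means $g^a \mid f$ but $g^{a+1} \nmid f$. $\mathrm{Div}(h)$ is the set of divisors of $h$ up to multiplication by nonzero constants. For nonconstant $f$ and $D \subset \mathrm{Div}(f)$ with $f \notin D$, the gcd-graph $G_f(D)$ is the simple undirected graph with vertex set $\mathbb{F}_q[x]/f$ in which $a,b$ are adjacent iff $\gcd(a-b,f) \in D$ (gcd taken up to nonzero constants). *)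

(* Defs.v *)
From mathcomp Require Import all_boot all_order all_algebra.
Set Implicit Arguments.
Unset Strict Implicit.
Unset Printing Implicit Defensive.
Import GRing.Theory.
Local Open Scope ring_scope.

(* Polynomials up to nonzero constants are encoded by their monic
   representatives (0 represents itself). *)
Definition monic_rep (F : fieldType) (p : {poly F}) : {poly F} :=
  (lead_coef p)^-1 *: p.

Definition Div (F : fieldType) (h : {poly F}) : {pred {poly F}} :=
  [pred d : {poly F} | (d \is monic) && (d %| h)].

Definition exactly_divides (F : fieldType) (g : {poly F}) (a : nat)
    (f : {poly F}) : bool :=
  (g ^+ a %| f) && ~~ (g ^+ a.+1 %| f).

(* The library quotient {poly %/ h} is F[x]/(h) only for monic nonconstant h
   (otherwise it silently falls back to F[x]/(x)), so f is replaced by the monic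
   generator of the same ideal; this is meaningful for nonconstant f only. *)
Definition gcd_vertex (F : finFieldType) (f : {poly F}) : finType :=
  {poly %/ monic_rep f}.

(* a - b is the difference in the quotient ring, read as the residue of degree
   less than deg f; see gcd_adj_in_qpoly for independence of representatives. *)
Definition gcd_adj (F : finFieldType) (f : {poly F}) (D : {pred {poly F}}) :
    rel (gcd_vertex f) :=
  fun a b : {poly %/ monic_rep f} =>
    monic_rep (gcdp (a - b : {poly %/ monic_rep f}) f) \in D.

Definition graph_iso (V1 V2 : finType) (e1 : rel V1) (e2 : rel V2) : Prop :=
  exists2 phi : V1 -> V2,
    bijective phi & forall x y : V1, e1 x y = e2 (phi x) (phi y).

Section GcdGraphTheory.
Variables (F : finFieldType) (f : {poly F}).
Implicit Types (p q g : {poly F}) (D : {pred {poly F}}).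

Lemma monic_rep_monic p : p != 0 -> monic_rep p \is monic.
Proof. by move=> p0; rewrite monicE lead_coefZ mulVf ?lead_coef_eq0. Qed.

Lemma eqp_monic_rep p : monic_rep p %= p.
Proof.
have [->|p0] := eqVneq p 0; first by rewrite /monic_rep scaler0 eqpxx.
by apply: eqp_scale; rewrite invr_eq0 lead_coef_eq0.
Qed.

Lemma monic_rep_eqp p q : p %= q -> monic_rep p = monic_rep q.
Proof.
have [->|p0 pq] := eqVneq p 0; first by rewrite eqp_sym eqp0 => /eqP->.
have q0 : q != 0 by apply: contraNneq p0 => q0; rewrite q0 eqp0 in pq.
apply/eqP; rewrite -eqp_monic ?monic_rep_monic //.
apply: eqp_trans (eqp_monic_rep p) (eqp_trans pq _).
by rewrite eqp_sym eqp_monic_rep.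
Qed.

Lemma mk_monic_rep : (1 < size f)%N -> mk_monic (monic_rep f) = monic_rep f.
Proof.
move=> f1; have f0 : f != 0 by rewrite -size_poly_gt0 ltnW.
by rewrite /mk_monic (eqp_size (eqp_monic_rep f)) f1 monic_rep_monic.
Qed.

Lemma gcd_adj_in_qpoly D p q : (1 < size f)%N ->
  @gcd_adj F f D (in_qpoly (monic_rep f) p) (in_qpoly (monic_rep f) q)
    = (monic_rep (gcdp (p - q) f) \in D).
Proof.
move=> f1; have f0 : f != 0 by rewrite -size_poly_gt0 ltnW.
rewrite /gcd_adj -raddfB; congr (_ \in D); apply: monic_rep_eqp.
rewrite /= mk_monic_rep // -Pdiv.IdomainMonic.modpE ?monic_rep_monic //.
apply: eqp_trans (gcdp_modl _ _).
by apply: eqp_gcdl; apply: Pdiv.Field.eqp_modpr; exact: eqp_monic_rep.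
Qed.

Lemma gcd_adj_sym D : symmetric (@gcd_adj F f D).
Proof.
move=> a b; rewrite /gcd_adj; congr (_ \in D); apply: monic_rep_eqp.
by apply: eqp_gcdl; rewrite !raddfB /= -opprB -scaleN1r eqp_scale // oppr_eq0 oner_eq0.
Qed.

Lemma gcd_adj_irr D : monic_rep f \notin D -> irreflexive (@gcd_adj F f D).
Proof. by move=> fD a; rewrite /gcd_adj subrr gcd0p; apply: negbTE. Qed.

Lemma Div_sub g : g %| f -> {subset Div g <= Div f}.
Proof.
by move=> gf d /andP[dm dg]; apply/andP; split; last exact: dvdp_trans gf.
Qed.

Lemma monic_rep_notin_Div_exp f1 f2 a :
  irreducible_poly f1 -> irreducible_poly f2 -> ~~ (f1 %= f2) -> f2 %| f ->
  monic_rep f \notin Div (f1 ^+ a).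
Proof.
move=> i1 i2 n12 f2f; apply/negP => /andP[_].
rewrite (eqp_dvdl _ (eqp_monic_rep f)) => ff1.
have s2 : (1 < size f2)%N by case: i2.
have c21 : coprimep f2 (f1 ^+ a).
  apply: coprimep_expr; rewrite coprimep_sym irreducible_poly_coprime //.
  apply: contra n12 => d12; apply: i2.2 => //.
  by case: i1 => s1 _; rewrite neq_ltn s1 orbT.
move: s2; rewrite ltn_neqAle eq_sym => /andP[/negP[]].
by rewrite -coprimepp; apply: coprimep_dvdl c21; apply: dvdp_trans ff1.
Qed.
End GcdGraphTheory.

(* Main.v *)
Require Import Defs.
From mathcomp Require Import all_boot all_order all_algebra.
From mathcomp Require Import ring.
Set Implicit Arguments.
Unset Strict Implicit.
Unset Printing Implicit Defensive.
Import GRing.Theory.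
Local Open Scope ring_scope.

(** Write [f = f1^a1 f2^a2 h]. A difference [p] has [gcd(p, f)] dividing
    [f1^a1] iff [p] is prime to [h] and [f2] does not divide [p]; symmetrically
    for [f2^a2]. So it suffices to find an additive involution of [F[x]/f] that
    fixes residues modulo [h] and exchanges the residues modulo [f1] and [f2],
    which makes sense because [deg f1 = deg f2]. If [e] is [1] mod [f1], [-1] mod
    [f2] and [0] mod [h], then [p |-> p + e (p mod f2 - p mod f1)] is one. *)

Lemma coprimep_chinese (F : fieldType) (p q a b : {poly F}) :
  coprimep p q -> exists r, (p %| r - a) && (q %| r - b).
Proof.
move=> /Bezout_eq1_coprimepP[[u v] /= uv1].
(* By the Bezout relation, [v * q] is 1 modulo [p] and 0 modulo [q], and [u * p] is the reverse. *)
exists (a * (v * q) + b * (u * p)).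
have -> : a * (v * q) + b * (u * p) - a = (b - a) * u * p.
  have -> : v * q = 1 - u * p by rewrite -uv1; ring.
  by ring.
have -> : a * (v * q) + b * (u * p) - b = (a - b) * v * q.
  have -> : u * p = 1 - v * q by rewrite -uv1; ring.
  by ring.
by rewrite !dvdp_mulIr.
Qed.

Section ResidueSwap.
Variables (F : fieldType) (g1 g2 e : {poly F}).
Implicit Types p q : {poly F}.

Definition residue_swap p := p + e * (p %% g2 - p %% g1).

Lemma residue_swapB p q :
  residue_swap (p - q) = residue_swap p - residue_swap q.
Proof. by rewrite /residue_swap !modpD !modpN; ring. Qed.

(** Together with additivity, this makes the swap well defined modulo any common multiple of [g1]
    and [g2], in particular modulo [f]. *)
Lemma residue_swap_fix p : g1 %| p -> g2 %| p -> residue_swap p = p.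
Proof.
by move=> /modp_eq0P d1 /modp_eq0P d2; rewrite /residue_swap d1 d2 subrr mulr0 addr0.
Qed.

Lemma coprimep_residue_swap h p :
  h %| e -> coprimep (residue_swap p) h = coprimep p h.
Proof.
move=> he; rewrite -coprimep_modl modpD.
by rewrite (modp_eq0P _ _ (dvdp_mulr _ he)) addr0 coprimep_modl.
Qed.

Hypotheses (g1_neq0 : g1 != 0) (g12_size : size g1 = size g2).
Hypotheses (e_g1 : g1 %| e - 1) (e_g2 : g2 %| e + 1).

(** Since [e] is 1 modulo [g1], the correction cancels [p %% g1] and puts [p %% g2] in its place. As
    [g1] and [g2] have equal size, [p %% g2] is already reduced modulo [g1]. *)
Lemma residue_swap_mod1 p : residue_swap p %% g1 = p %% g2.
Proof.
have -> : residue_swap p =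
    (e - 1) * (p %% g2 - p %% g1) + (p - p %% g1) + p %% g2.
  by rewrite /residue_swap; ring.
rewrite 2!modpD (modp_eq0P _ _ (dvdp_mulr _ e_g1)) add0r modpD modpN modp_id subrr.
rewrite add0r modp_small // g12_size ltn_modp -size_poly_gt0 -g12_size.
by rewrite size_poly_gt0.
Qed.

Lemma residue_swap_mod2 p : residue_swap p %% g2 = p %% g1.
Proof.
have -> : residue_swap p =
    (e + 1) * (p %% g2 - p %% g1) + (p - p %% g2) + p %% g1.
  by rewrite /residue_swap; ring.
rewrite 2!modpD (modp_eq0P _ _ (dvdp_mulr _ e_g2)) add0r modpD modpN modp_id subrr.
by rewrite add0r modp_small // -g12_size ltn_modp.
Qed.

(** Exchanging the residues flips the sign of the correction, so the second one undoes the first,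
    already on polynomials and not just modulo [f]. *)
Lemma residue_swapK : involutive residue_swap.
Proof.
move=> p; rewrite {1}/residue_swap residue_swap_mod1 residue_swap_mod2.
by rewrite /residue_swap; ring.
Qed.

End ResidueSwap.

Lemma in_qpoly_monic_rep_eq (F : finFieldType) (f p q : {poly F}) :
  (1 < size f)%N -> f %| p - q ->
  in_qpoly (monic_rep f) p = in_qpoly (monic_rep f) q.
Proof.
move=> f1 fpq; have f0 : f != 0 by rewrite -size_poly_gt0 ltnW.
apply/eqP; rewrite -subr_eq0 -raddfB; apply/eqP/val_inj => /=.
rewrite mk_monic_rep // -Pdiv.IdomainMonic.modpE ?monic_rep_monic //.
by apply/modp_eq0P; rewrite (eqp_dvdl _ (eqp_monic_rep f)).
Qed.

Lemma gcdp_in_Div_coprimep (F : finFieldType) (m r p : {poly F}) :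
  m * r != 0 -> coprimep m r ->
  (monic_rep (gcdp p (m * r)) \in Div m) = coprimep p r.
Proof.
move=> mr0 cmr; have g0 : gcdp p (m * r) != 0.
  by rewrite gcdp_eq0 negb_and mr0 orbT.
rewrite inE monic_rep_monic //= (eqp_dvdl _ (eqp_monic_rep _)).
apply/idP/idP => [gm | cpr].
  have grm : gcdp p r %| m.
    apply: dvdp_trans gm; rewrite dvdp_gcd dvdp_gcdl.
    by rewrite (dvdp_trans (dvdp_gcdr _ _)) ?dvdp_mulIr.
  (* [gcdp p r] divides both [m] and [r], which are coprime. *)
  rewrite /coprimep -dvdp1; move: cmr; rewrite -gcdp_eqp1 => /eqp_dvdr <-.
  by rewrite dvdp_gcd grm dvdp_gcdr.
by rewrite (eqp_dvdl _ (Gauss_gcdpl _ cpr)) dvdp_gcdr.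
Qed.

Theorem corollary5p11 (F : finFieldType) (f f1 f2 : {poly F}) (a1 a2 : nat)
  (f_neq0 : f != 0)
  (f1_irr : irreducible_poly f1) (f2_irr : irreducible_poly f2)
  (f1_dvd : f1 %| f) (f2_dvd : f2 %| f)
  (f12_distinct : ~~ (f1 %= f2))
  (f12_size : size f1 = size f2)
  (a1_gt0 : (0 < a1)%N) (a2_gt0 : (0 < a2)%N)
  (f1_exact : exactly_divides f1 a1 f) (f2_exact : exactly_divides f2 a2 f) :
  graph_iso (@gcd_adj F f (Div (f1 ^+ a1))) (@gcd_adj F f (Div (f2 ^+ a2))).
Proof.
have f1_neq0 := irredp_neq0 f1_irr.
have f_size : (1 < size f)%N.
  by apply: leq_trans (dvdp_leq f_neq0 f1_dvd); case: f1_irr.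
have c12 : coprimep f1 f2.
  rewrite irreducible_poly_coprime //.
  apply: contra f12_distinct => d12; apply: f2_irr.2 => //.
  by case: f1_irr => s1 _; rewrite neq_ltn s1 orbT.
case/andP: f1_exact => d1 nd1; case/andP: f2_exact => d2 nd2.
have [h def_f] : exists h, f = f1 ^+ a1 * (f2 ^+ a2 * h).
  have /dvdpP[h ->] : f1 ^+ a1 * f2 ^+ a2 %| f.
    by rewrite Gauss_dvdp ?d1 // coprimep_expl // coprimep_expr.
  by exists h; ring.
have def_f' : f = f2 ^+ a2 * (f1 ^+ a1 * h) by rewrite def_f; ring.
(* Exactness of the exponent: one more factor [f1] in [h] would give [f1 ^+ a1.+1 %| f]. *)
have c1h : coprimep f1 h.
  rewrite irreducible_poly_coprime //; apply: contra nd1 => f1h.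
  by rewrite def_f exprSr dvdp_mul // dvdp_mull.
have c2h : coprimep f2 h.
  rewrite irreducible_poly_coprime //; apply: contra nd2 => f2h.
  by rewrite def_f' exprSr dvdp_mul // dvdp_mull.
(* Two rounds of Chinese remainders: first modulo [f1] and [f2], then modulo [f1 * f2] and [h]. *)
have [e [e1 e2 eh]] : exists e, [/\ f1 %| e - 1, f2 %| e + 1 & h %| e].
  have [s /andP[s1 s2]] := coprimep_chinese 1 (-1) c12.
  have c12h : coprimep (f1 * f2) h by rewrite coprimepMl c1h.
  have [e /andP[e12 eh]] := coprimep_chinese s 0 c12h.
  exists e; split; last by rewrite subr0 in eh.
    have -> : e - 1 = (e - s) + (s - 1) by ring.
    by rewrite dvdp_add // (dvdp_trans _ e12) // dvdp_mulIl.
  have -> : e + 1 = (e - s) + (s - -1) by ring.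
  by rewrite dvdp_add // (dvdp_trans _ e12) // dvdp_mulIr.
pose sw := residue_swap f1 f2 e.
pose V := {poly %/ monic_rep f}.
pose phi (a : V) : V := in_qpoly (monic_rep f) (sw a).
have in_qK (a : V) : in_qpoly (monic_rep f) a = a.
  exact/val_inj/in_qpoly_small/size_mk_monic.
(* [phi] may be computed on any representative, because [sw] is additive and fixes multiples of
   [f]. *)
have phi_in p : phi (in_qpoly (monic_rep f) p) = in_qpoly (monic_rep f) (sw p).
  have d_pq : f %| (in_qpoly (monic_rep f) p : {poly F}) - p.
    rewrite /= mk_monic_rep // -Pdiv.IdomainMonic.modpE ?monic_rep_monic //.
    rewrite -(eqp_dvdl _ (eqp_monic_rep f)) -opprB dvdpNr.
    by rewrite {1}(divp_eq p (monic_rep f)) addrK dvdp_mulIr.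
  apply: in_qpoly_monic_rep_eq => //.
  by rewrite -residue_swapB residue_swap_fix // (dvdp_trans _ d_pq).
have phiK : involutive phi.
  by move=> a; rewrite {2}/phi phi_in /sw residue_swapK // in_qK.
have adj_sw p : (monic_rep (gcdp p f) \in Div (f1 ^+ a1)) =
                (monic_rep (gcdp (sw p) f) \in Div (f2 ^+ a2)).
  rewrite {1}def_f def_f' !gcdp_in_Div_coprimep -?def_f -?def_f' //.
  (* Positive exponents drop out of coprimality. The [h] parts agree because [h %| e], and [f2]
     divides [p] iff [f1] divides [sw p], as [sw p %% f1 = p %% f2]. *)
  - rewrite !coprimepMr !coprimep_pexpr // (coprimep_residue_swap _ _ _ eh).
    rewrite (coprimep_sym _ f2) (coprimep_sym _ f1) (irreducible_poly_coprime _ f2_irr).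
    by rewrite (irreducible_poly_coprime _ f1_irr) /dvdp residue_swap_mod1.
  - by rewrite coprimepMr !coprimep_expl ?coprimep_expr // coprimep_sym.
  - by rewrite coprimepMr !coprimep_expl ?coprimep_expr.
exists phi; first exact: inv_bij phiK.
move=> a b; rewrite -(in_qK a) -(in_qK b) !phi_in !gcd_adj_in_qpoly //.
by rewrite -residue_swapB adj_sw.
Qed.
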